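(* Fix $x \in (0,1)$. There is a constant $C=C(x)$ such that for every $\epsilon>0$ and every finite interval $I\subset\mathbb{R}$ there exist a nonnegative integrable function $f$ on $I$ with $\langle f \rangle_I = x$ and a Carleson sequence $\{\alpha_J\}_{J \in \mathcal{D}(I)}$ with Carleson constant at most one and satisfying $$\frac{1}{|I|}\sum_{J \in \mathcal{D}(I)} \alpha_J |J| = 1,$$ such that $$\frac{1}{|I|}\Bigl| \Bigl\{ y\in I:\ \sum_{J \in \mathcal{D}(I)} \alpha_J \langle f\rangle_J \mathbf{1}_J(y) > 1 \Bigr\} \Bigr| = \frac{2x}{x+1} + O(\epsilon),$$ where $O(\epsilon)$ denotes a quantity of absolute value at most $C\epsilon$.
   Context: For a finite interval $I=[a,b)\subset\mathbb{R}$, $\mathcal{D}(I)$ is the collection of dyadic subintervals of $I$ (including $I$ itself), i.e. the half-open intervals obtained by repeatedly bisecting $I$. $|E|$ denotes Lebesgue measure, $\langle f\rangle_J=\frac{1}{|J|}\int_J f$, and $\mathbf{1}_J$ is the indicator function of $J$. A Carleson sequence on $I$ is a family $\{\alpha_J\}_{J\in\mathcal{D}(I)}$ with $\alpha_J\ge 0$ whose Carleson constant $\sup_{J\in\mathcal{D}(I)}\frac{1}{|J|}\sum_{K\in\mathcal{D}(J)}\alpha_K|K|$ is finite. *)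

(* Defs.v *)
From HB Require Import structures.
From mathcomp Require Import all_boot all_order all_algebra.
From mathcomp Require Import all_classical all_reals all_analysis.
Set Implicit Arguments.
Unset Strict Implicit.
Unset Printing Implicit Defensive.
Import Order.TTheory GRing.Theory Num.Theory.
Import numFieldNormedType.Exports.
Local Open Scope classical_set_scope.
Local Open Scope ring_scope.

Inductive dyadic (R : realType) (I : set R) : set (set R) :=
| dyadic_self : dyadic I I
| dyadic_left (a b : R) :
    a < b -> dyadic I `[a, b[%classic -> dyadic I `[a, (a + b) / 2[%classic
| dyadic_right (a b : R) :
    a < b -> dyadic I `[a, b[%classic -> dyadic I `[(a + b) / 2, b[%classic.

(* |E|; its inverse is only taken for intervals of finite positive measure *)
Definition leb (R : realType) (E : set R) : \bar R :=
  (@lebesgue_measure R) E.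

Definition average (R : realType) (f : R -> R) (J : set R) : R :=
  (fine (leb J))^-1 * \int[@lebesgue_measure R]_(y in J) f y.

Definition carleson_average (R : realType) (alpha : set R -> R) (J : set R) :
    \bar R :=
  (((fine (leb J))^-1)%:E *
   \esum_(K in dyadic J) ((alpha K)%:E * leb K))%E.

Definition carleson_constant (R : realType) (I : set R) (alpha : set R -> R) :
    \bar R :=
  ereal_sup [set carleson_average alpha J | J in dyadic I].

(* A family indexed by the dyadic subintervals of I is encoded as a function
   on all sets; its values outside dyadic I are irrelevant. *)
Definition carleson_sequence (R : realType) (I : set R) (alpha : set R -> R) :
    Prop :=
  (forall J, dyadic I J -> 0 <= alpha J) /\ (carleson_constant I alpha < +oo)%E.

Definition carleson_operator (R : realType) (I : set R) (alpha : set R -> R)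
    (f : R -> R) (y : R) : \bar R :=
  \esum_(J in dyadic I) (alpha J * average f J * \1_J y)%:E.

(* Main.v *)
Require Import Defs.
From HB Require Import structures.
From mathcomp Require Import all_boot all_order all_algebra.
From mathcomp Require Import all_classical all_reals all_analysis.
From mathcomp Require Import ring lra.
Set Implicit Arguments.
Unset Strict Implicit.
Unset Printing Implicit Defensive.
Import Order.TTheory GRing.Theory Num.Theory.
Import numFieldNormedType.Exports.
Local Open Scope classical_set_scope.
Local Open Scope ring_scope.

(** Write B(x, A, lam) for the largest relative size of the set where a Carleson
operator exceeds lam on an interval on which the density has average x and the
Carleson sequence has average A.  The example follows, in small steps, the
characteristic of B that stays on the face A = 1.

Fix d = 2^-n and p = 1 - d.  On an interval with data (x, 1, lam) put a weight d
on the interval itself.  This adds d x to the operator everywhere, leaves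
Carleson average 1 - d to be distributed below, and lowers the threshold to
lam - d x.  Then discard a dyadic subinterval of proportion d, giving it zero
density and zero weights, and concentrate everything on the rest: there the
density has average x / p and the Carleson average is 1 again.  So one step
reads (x, 1, lam) -> (x / p, 1, lam - d x) and keeps a proportion p of the
interval; in the limit d -> 0, homogeneity in (x, lam) turns it into
x (1 + x) B' = B for B(x) = B(x, 1, 1), and B(1) = 1 gives
B(x) = 2 x / (1 + x).  This is [attains_step], and [attains_iter] repeats it.

After N steps the surviving set has relative measure p^N, constant density
x p^-N, and threshold 1 - x p (p^-N - 1).  If this threshold is nonnegative and
smaller than the density, a weight 1 on the surviving intervals pushes the
operator above 1 on the surviving set, while on the discarded intervals it stays
at most 1.  These two conditions on N say that
x p / (1 + x p) <= p^N < T with T = x (1 + p) / (1 + x p).  The least N with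
p^N < T satisfies p T <= p^N, which is more than the lower bound asks for, and
both T and p T are within O(d) of 2 x / (1 + x).

The dyadic bookkeeping is absorbed by [realizes_glue], which puts two
configurations with the same threshold on the two halves of an interval and adds
one weight on the whole interval; everything else is obtained from constant
configurations by gluing. *)

(** * Dyadic subintervals *)

Lemma leb_itv (R : realType) (a b : R) :
  a < b -> leb `[a, b[%classic = (b - a)%:E.
Proof. by move=> ab; rewrite /leb lebesgue_measure_itv /= lte_fin ab EFinN EFinD. Qed.

Lemma itv_co_inj (R : realType) (a b c d : R) : a < b -> c < d ->
  `[a, b[%classic = `[c, d[%classic -> a = c /\ b = d.
Proof.
move=> ab cd E.
have mem y : (a <= y < b) = (c <= y < d).
  have := congr1 (fun S : set R => S y) E; rewrite /= !in_itv /= => e.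
  by apply/idP/idP; rewrite e.
have /andP[ca ad] : c <= a < d by rewrite -mem lexx.
have /andP[ac cb] : a <= c < b by rewrite mem lexx.
split; first by apply/eqP; rewrite eq_le ac.
have [bd|db|//] := ltgtP b d.
- by have := mem b; rewrite ltxx andbF (le_trans ca (ltW ab)) bd.
- by have := mem d; rewrite ltxx andbF (le_trans ac (ltW cd)) db.
Qed.

Lemma midpoint_lt (R : realType) (a b : R) : a < b -> a < (a + b) / 2 < b.
Proof. by move=> ab; apply/andP; split; lra. Qed.

Lemma dyadic_itv (R : realType) (a b : R) (J : set R) : a < b ->
  dyadic `[a, b[%classic J ->
  exists c d : R, [/\ a <= c, c < d, d <= b & J = `[c, d[%classic].
Proof.
move=> ab; elim=> [|c d cd _ [c' [d' [ac' cd' db' E]]]|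
                   c d cd _ [c' [d' [ac' cd' db' E]]]].
- by exists a, b.
- have [? ?] := itv_co_inj cd cd' E; subst c' d'.
  have /andP[h1 h2] := midpoint_lt cd.
  by exists c, ((c + d) / 2); split=> //; lra.
- have [? ?] := itv_co_inj cd cd' E; subst c' d'.
  have /andP[h1 h2] := midpoint_lt cd.
  by exists ((c + d) / 2), d; split=> //; lra.
Qed.

Lemma dyadic_trans (R : realType) (I J K : set R) :
  dyadic I J -> dyadic J K -> dyadic I K.
Proof.
by move=> IJ; elim=> // c d cd _ IH; [apply: dyadic_left|apply: dyadic_right].
Qed.

(** Dyadic subintervals are generated from the top by halving; this is the
recursion from the bottom, on which gluing rests. *)
Lemma dyadicE (R : realType) (a b : R) : a < b ->
  dyadic `[a, b[%classic = [set `[a, b[%classic] `|`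
    (dyadic `[a, (a + b) / 2[%classic `|` dyadic `[(a + b) / 2, b[%classic).
Proof.
move=> ab; apply/seteqP; split=> J.
- elim=> [|c d cd _ [E|[H|H]]|c d cd _ [E|[H|H]]].
  + by left.
  + have [-> ->] := itv_co_inj cd ab E.
    by right; left; apply: dyadic_self.
  + by right; left; apply: dyadic_left.
  + by right; right; apply: dyadic_left.
  + have [-> ->] := itv_co_inj cd ab E.
    by right; right; apply: dyadic_self.
  + by right; left; apply: dyadic_right.
  + by right; right; apply: dyadic_right.
- move=> [->|[H|H]]; first exact: dyadic_self.
  + by apply: dyadic_trans H; apply: dyadic_left => //; apply: dyadic_self.
  + by apply: dyadic_trans H; apply: dyadic_right => //; apply: dyadic_self.
Qed.

Lemma dyadic_sub (R : realType) (a b : R) (J : set R) : a < b ->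
  dyadic `[a, b[%classic J -> J `<=` `[a, b[%classic.
Proof.
move=> ab /(dyadic_itv ab)[c [d [ac cd db ->]]] y /=.
by rewrite !in_itv /= => /andP[cy yd]; rewrite (le_trans ac cy) (lt_le_trans yd db).
Qed.

Lemma dyadic_nonempty (R : realType) (a b : R) (J : set R) : a < b ->
  dyadic `[a, b[%classic J -> exists y, J y.
Proof.
move=> ab /(dyadic_itv ab)[c [d [ac cd db ->]]].
by exists c; rewrite /= in_itv /= lexx cd.
Qed.

Lemma dyadic_left_neq (R : realType) (a b : R) (J : set R) : a < b ->
  dyadic `[a, (a + b) / 2[%classic J -> J <> `[a, b[%classic.
Proof.
move=> ab; have /andP[am mb] := midpoint_lt ab => H E.
have := dyadic_sub am H; rewrite E => /(_ ((a + b) / 2)).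
by rewrite /= !in_itv /= ltxx andbF (ltW am) mb; move=> /(_ isT).
Qed.

Lemma dyadic_right_not_subset (R : realType) (a b : R) (J : set R) : a < b ->
  dyadic `[(a + b) / 2, b[%classic J -> ~ J `<=` `[a, (a + b) / 2[%classic.
Proof.
move=> ab; have /andP[am mb] := midpoint_lt ab => H sub.
have [y Jy] := dyadic_nonempty mb H.
have := sub _ Jy; have := dyadic_sub mb H Jy.
by rewrite /= !in_itv /= => /andP[my _] /andP[_ ym]; move: my; rewrite leNgt ym.
Qed.

Lemma dyadic_right_neq (R : realType) (a b : R) (J : set R) : a < b ->
  dyadic `[(a + b) / 2, b[%classic J -> J <> `[a, b[%classic.
Proof.
move=> ab; have /andP[am mb] := midpoint_lt ab => H E.
have := dyadic_sub mb H; rewrite E => /(_ a).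
by rewrite /= !in_itv /= lexx ab (leNgt _ a) am; move=> /(_ isT).
Qed.

(** * Sums over dyadic families *)

Lemma esumU (R : realType) (T : choiceType) (A B : set T) (F : T -> \bar R) :
  A `&` B = set0 -> (forall i, (0 <= F i)%E) ->
  \esum_(i in A `|` B) F i = (\esum_(i in A) F i + \esum_(i in B) F i)%E.
Proof.
move=> AB F0; rewrite (esumID A) //; congr (_ + _)%E.
  by congr esum; apply/seteqP; split=> [i []//|i Ai]; split => //; left.
congr esum; apply/seteqP; split=> [i [[]//]|i Bi]; split; first by right.
by move=> Ai; have : (A `&` B) i by []; rewrite AB.
Qed.

Lemma esum_dyadic (R : realType) (a b : R) (F : set R -> \bar R) : a < b ->
  (forall J, (0 <= F J)%E) ->
  \esum_(J in dyadic `[a, b[%classic) F J =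
  (F `[a, b[%classic + (\esum_(J in dyadic `[a, ((a + b) / 2)%R[%classic) F J +
                        \esum_(J in dyadic `[((a + b) / 2)%R, b[%classic) F J))%E.
Proof.
move=> ab F0; rewrite (dyadicE ab) !esumU ?esum_set1 //.
  apply/seteqP; split=> // J [HL HR].
  by apply: dyadic_right_not_subset HR _ => //;
    apply: dyadic_sub HL; have /andP[] := midpoint_lt ab.
apply/seteqP; split=> // J [/= -> [HL|HR]].
- exact: (dyadic_left_neq ab HL).
- exact: (dyadic_right_neq ab HR).
Qed.

(** * Configurations on an interval *)

Definition superlevel (R : realType) (I : set R) (alpha : set R -> R)
    (f : R -> R) (lam : R) : set R :=
  [set y | I y /\ (lam%:E < carleson_operator I alpha f y)%E].

Definition carleson_mass (R : realType) (alpha : set R -> R) (J : set R) :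
    \bar R :=
  \esum_(K in dyadic J) ((alpha K)%:E * leb K)%E.

(** Gluing has to preserve every field.  Hence nonnegativity is global, so that
it does not depend on the interval, masses are stated without division, so that
they add up over the two halves, and m is an exact proportion. *)
Record realizes (R : realType) (a b : R) (f : R -> R) (alpha : set R -> R)
    (x A lam m : R) : Prop := Realizes {
  density_ge0 : forall y, 0 <= f y;
  weight_ge0 : forall J, 0 <= alpha J;
  density_integrable :
    (@lebesgue_measure R).-integrable `[a, b[%classic (EFin \o f);
  density_integral :
    \int[@lebesgue_measure R]_(y in `[a, b[%classic) f y = x * (b - a);
  mass_total : carleson_mass alpha `[a, b[%classic = (A * (b - a))%:E;
  mass_carleson : forall J, dyadic `[a, b[%classic J ->
    (carleson_mass alpha J <= leb J)%E;
  superlevel_measurable :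
    measurable (superlevel `[a, b[%classic alpha f lam);
  superlevel_leb :
    leb (superlevel `[a, b[%classic alpha f lam) = (m * (b - a))%:E }.

(** Quantifying over all intervals makes the data (x, A, lam, m) a statement
about the Bellman function alone, free to be used at any place and scale. *)
Definition attains (R : realType) (x A lam m : R) : Prop :=
  forall a b : R, a < b -> exists f alpha, realizes a b f alpha x A lam m.

Lemma average_itv (R : realType) (a b x : R) (f : R -> R) : a < b ->
  \int[@lebesgue_measure R]_(y in `[a, b[%classic) f y = x * (b - a) ->
  average f `[a, b[%classic = x.
Proof.
move=> ab E; rewrite /average E leb_itv //=.
by rewrite mulrCA mulVf ?mulr1 // subr_eq0 gt_eqF.
Qed.

Lemma average_ge0 (R : realType) (f : R -> R) (J : set R) :
  (forall y, 0 <= f y) -> 0 <= average f J.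
Proof.
move=> f0; apply: mulr_ge0; last exact: Rintegral_ge0.
by rewrite invr_ge0 fine_ge0 // /leb; exact: measure_ge0.
Qed.

(** * Constant configurations *)

Definition top_weight (R : realType) (I : set R) (t : R) (J : set R) : R :=
  if `[< J = I >] then t else 0.

Lemma top_weight_ge0 (R : realType) (I : set R) (t : R) (J : set R) :
  0 <= t -> 0 <= top_weight I t J.
Proof. by rewrite /top_weight; case: ifP. Qed.

Lemma top_weightE (R : realType) (I : set R) (t : R) : top_weight I t I = t.
Proof. by rewrite /top_weight; case: asboolP. Qed.

(** The hypothesis on J excludes the case where I lies strictly below J, so that
the only weight that can be seen from J sits on J itself. *)
Lemma esum_top_weight (R : realType) (I J : set R) (t : R) (G : set R -> \bar R) :
  0 <= t -> (forall K, 0 <= G K)%E -> (dyadic J I -> J = I) ->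
  \esum_(K in dyadic J) ((top_weight I t K)%:E * G K)%E =
  ((top_weight I t J)%:E * G J)%E.
Proof.
move=> t0 G0 JI.
have F0 K : (0 <= (top_weight I t K)%:E * G K)%E.
  by rewrite mule_ge0 ?lee_fin ?top_weight_ge0.
rewrite (esumID [set J]); last by move=> K _.
rewrite [X in (_ + X)%E]esum1 ?adde0; last first.
  move=> K [JK /= KJ]; rewrite /top_weight; case: asboolP => [KI|_].
    by case: KJ; rewrite KI in JK *; rewrite JI.
  by rewrite mul0e.
have -> : dyadic J `&` [set J] = [set J].
  by apply/seteqP; split=> [K []//|K /= ->]; split => //; apply: dyadic_self.
by rewrite esum_set1.
Qed.

(** Constant density x and a single weight t on the whole interval: the operator
is constantly t x.  With t = 1 this ends the construction; with x = t = 0 it is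
what a discarded interval carries. *)
Lemma attains_const (R : realType) (x t lam : R) : 0 <= x -> 0 <= t <= 1 ->
  attains x t lam (if lam < t * x then 1 else 0).
Proof.
move=> x0 /andP[t0 t1] a b ab; set I := `[a, b[%classic.
have mI : measurable I by exact: measurable_itv.
have cint : \int[@lebesgue_measure R]_(y in I) x = x * (b - a).
  have -> : b - a = fine (leb I) by rewrite leb_itv.
  by rewrite Rintegral_cst.
have leb_ge0 J : (0 <= leb J)%E by rewrite /leb; exact: measure_ge0.
have mass J : dyadic I J ->
    carleson_mass (top_weight I t) J = ((top_weight I t J)%:E * leb J)%E.
  move=> IJ; rewrite /carleson_mass esum_top_weight // => JI.
  have [c [d [_ cd _ EJ]]] := dyadic_itv ab IJ.
  apply/seteqP; split; first exact: dyadic_sub ab IJ.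
  by rewrite EJ in JI *; apply: dyadic_sub cd JI.
have II : dyadic I I by apply: dyadic_self.
have op y : I y -> carleson_operator I (top_weight I t) (cst x) y = (t * x)%:E.
  move=> Iy; rewrite /carleson_operator.
  under eq_esum do rewrite -mulrA EFinM.
  rewrite esum_top_weight //; last first.
    by move=> K; rewrite lee_fin mulr_ge0 ?average_ge0.
  by rewrite top_weightE (average_itv ab cint) indicE mem_set // mulr1.
have sup : superlevel I (top_weight I t) (cst x) lam =
    if lam < t * x then I else set0.
  apply/seteqP; split=> y; rewrite /superlevel /=.
    by move=> [Iy]; rewrite op // lte_fin => ->.
  by case: ifP => // h Iy; rewrite op // lte_fin.
exists (cst x), (top_weight I t); split => //.
- by move=> J; apply: top_weight_ge0.
- apply: measurable_bounded_integrable => //.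
    by rewrite [X in (X < _)%E](leb_itv ab) ltry.
  exact: bounded_cst.
- by rewrite mass // top_weightE leb_itv.
- move=> J IJ; rewrite mass // -[leRHS]mul1e lee_wpmul2r // lee_fin.
  by rewrite /top_weight; case: ifP.
- by rewrite sup; case: ifP.
- rewrite sup; case: ifP => _; first by rewrite leb_itv // mul1r.
  by rewrite /leb measure0 mul0r.
Qed.

(** * Gluing two configurations *)

Lemma eq_average (R : realType) (f g : R -> R) (J : set R) :
  {in J, f =1 g} -> average f J = average g J.
Proof. by move=> fg; congr (_ * _); apply: eq_Rintegral. Qed.

Lemma eq_carleson_operator (R : realType) (I : set R) (alpha beta : set R -> R)
    (f g : R -> R) (y : R) :
  (forall J, dyadic I J -> alpha J = beta J) ->
  (forall J, dyadic I J -> {in J, f =1 g}) ->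
  carleson_operator I alpha f y = carleson_operator I beta g y.
Proof.
move=> ab fg; apply: eq_esum => J IJ.
by rewrite ab // (eq_average (fg J IJ)).
Qed.

Lemma eq_carleson_mass (R : realType) (alpha beta : set R -> R) (J : set R) :
  (forall K, dyadic J K -> alpha K = beta K) ->
  carleson_mass alpha J = carleson_mass beta J.
Proof. by move=> ab; apply: eq_esum => K JK; rewrite ab. Qed.

Lemma integrable_setU (d : measure_display) (T : measurableType d)
    (R : realType) (mu : {measure set T -> \bar R}) (A B : set T)
    (f : T -> \bar R) :
  measurable A -> measurable B -> [disjoint A & B] ->
  mu.-integrable A f -> mu.-integrable B f -> mu.-integrable (A `|` B) f.
Proof.
move=> mA mB AB iA iB.
have mf := (measurable_funU _ mA mB).2
  (conj (measurable_int mu iA) (measurable_int mu iB)).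
have mnf := (measurable_funU _ mA mB).2
  (conj (measurable_int mu (integrable_abse iA)) (measurable_int mu (integrable_abse iB))).
apply/integrableP; split=> //; rewrite ge0_integral_setU //.
by apply: lte_add_pinfty; [case/integrableP: iA|case/integrableP: iB].
Qed.

Definition glue_density (R : realType) (c : R) (f g : R -> R) (y : R) : R :=
  if y < c then f y else g y.

(** Both halves may only contribute weights at their own dyadic subintervals, so
it is enough to separate those contained in the left half L from the others. *)
Definition glue_weight (R : realType) (I L : set R) (t : R)
    (alpha beta : set R -> R) (J : set R) : R :=
  if `[< J = I >] then t else if `[< J `<=` L >] then alpha J else beta J.

(** On each half the operator is t times the global average plus the operator of
that half, because the dyadic subintervals of the other half do not meet it.
This shifts the threshold by that amount, and the superlevel set is the union
of the two given ones. *)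
Lemma realizes_glue (R : realType) (a b : R) (f1 f2 : R -> R)
    (alpha1 alpha2 : set R -> R) (x1 A1 m1 x2 A2 m2 lam t : R) : a < b ->
  0 <= t -> (A1 + A2) / 2 + t <= 1 ->
  realizes a ((a + b) / 2) f1 alpha1 x1 A1 lam m1 ->
  realizes ((a + b) / 2) b f2 alpha2 x2 A2 lam m2 ->
  realizes a b (glue_density ((a + b) / 2) f1 f2)
    (glue_weight `[a, b[%classic `[a, (a + b) / 2[%classic t alpha1 alpha2)
    ((x1 + x2) / 2) ((A1 + A2) / 2 + t) (lam + t * ((x1 + x2) / 2))
    ((m1 + m2) / 2).
Proof.
move=> ab t0 At1 r1 r2.
have /andP[am mb] := midpoint_lt ab.
set c := (a + b) / 2 in am mb r1 r2 *.
set I := `[a, b[%classic; set L := `[a, c[%classic; set Rt := `[c, b[%classic.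
set f := glue_density _ _ _; set alpha := glue_weight _ _ _ _ _.
set x := (x1 + x2) / 2.
have IE : I = L `|` Rt.
  by rewrite /I (itv_bndbnd_setU (x := BLeft c)) // bnd_simp ltW.
have LR0 : L `&` Rt = set0.
  apply/seteqP; split=> // y [Ly Ry]; move: Ly Ry.
  rewrite /L /Rt /= !in_itv /= => /andP[_ yc] /andP[cy _].
  by move: yc; rewrite ltNge cy.
have LR : [disjoint L & Rt] by apply/disj_set2P.
have fL : {in L, f =1 f1}.
  move=> y /set_mem; rewrite /L /= in_itv /= => /andP[_ yc].
  by rewrite /f /glue_density yc.
have fR : {in Rt, f =1 f2}.
  move=> y /set_mem; rewrite /Rt /= in_itv /= => /andP[cy _].
  by rewrite /f /glue_density ltNge cy.
have alphaI : alpha I = t by rewrite /alpha /glue_weight; case: asboolP.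
have alphaL J : dyadic L J -> alpha J = alpha1 J.
  move=> LJ; rewrite /alpha /glue_weight.
  case: asboolP => [/(dyadic_left_neq ab LJ)//|_].
  by case: asboolP => // -[]; apply: dyadic_sub am LJ.
have alphaR J : dyadic Rt J -> alpha J = alpha2 J.
  move=> RJ; rewrite /alpha /glue_weight.
  case: asboolP => [/(dyadic_right_neq ab RJ)//|_].
  by case: asboolP => // /(dyadic_right_not_subset ab RJ).
have f0 y : 0 <= f y.
  by rewrite /f /glue_density; case: ifP; rewrite (density_ge0 r1, density_ge0 r2).
have a0 J : 0 <= alpha J.
  rewrite /alpha /glue_weight; case: ifP => // _.
  by case: ifP; rewrite (weight_ge0 r1, weight_ge0 r2).
have leb_ge0 J : (0 <= leb J)%E by rewrite /leb; exact: measure_ge0.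
have mL : measurable L by exact: measurable_itv.
have mR : measurable Rt by exact: measurable_itv.
have mI : measurable I by exact: measurable_itv.
have intL : (@lebesgue_measure R).-integrable L (EFin \o f).
  apply: eq_integrable (density_integrable r1) => // y Ly /=.
  by rewrite fL.
have intR : (@lebesgue_measure R).-integrable Rt (EFin \o f).
  apply: eq_integrable (density_integrable r2) => // y Ly /=.
  by rewrite fR.
have intI : (@lebesgue_measure R).-integrable I (EFin \o f).
  by rewrite IE; apply: integrable_setU.
have fI : \int[@lebesgue_measure R]_(y in I) f y = x * (b - a).
  have -> : \int[@lebesgue_measure R]_(y in I) f y =
      \int[@lebesgue_measure R]_(y in L) f1 y +
      \int[@lebesgue_measure R]_(y in Rt) f2 y.
    rewrite IE Rintegral_setU -?IE //.
    by congr (_ + _); apply: eq_Rintegral.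
  rewrite (density_integral r1) (density_integral r2) /x /c; lra.
have massI : carleson_mass alpha I = (((A1 + A2) / 2 + t) * (b - a))%:E.
  rewrite /carleson_mass esum_dyadic //; last by move=> J; rewrite mule_ge0 ?lee_fin.
  rewrite -/I -/c -/L -/Rt -!/(carleson_mass alpha _).
  rewrite (eq_carleson_mass alphaL) (eq_carleson_mass alphaR).
  rewrite (mass_total r1) (mass_total r2) alphaI leb_itv //.
  by rewrite -EFinM -!EFinD /c; congr EFin; lra.
have avgI : average f I = x by exact: average_itv.
have opE y : I y -> carleson_operator I alpha f y = ((t * x)%:E +
    (carleson_operator L alpha f y + carleson_operator Rt alpha f y))%E.
  move=> Iy; rewrite /carleson_operator esum_dyadic //; last first.
    by move=> J; rewrite lee_fin mulr_ge0 // mulr_ge0 ?average_ge0.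
  by rewrite -/I -/c -/L -/Rt alphaI avgI indicE mem_set // mulr1.
have op0 (p q y : R) : p < q -> ~ `[p, q[%classic y ->
    carleson_operator `[p, q[%classic alpha f y = 0%E.
  move=> pq ny; apply: esum1 => J /(dyadic_sub pq) Jpq.
  by rewrite indicE memNset /= ?mulr0 // => Jy; apply: ny; apply: Jpq.
have opL y : L y -> carleson_operator I alpha f y =
    ((t * x)%:E + carleson_operator L alpha1 f1 y)%E.
  move=> Ly; rewrite opE; last by rewrite IE; left.
  rewrite (op0 c) // ?adde0; last by move=> Ry; rewrite -[False]/(set0 y) -LR0.
  congr (_ + _)%E; apply: eq_carleson_operator => // J LJ z /set_mem Jz.
  by apply: fL; apply/mem_set; apply: dyadic_sub am LJ z Jz.
have opR y : Rt y -> carleson_operator I alpha f y =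
    ((t * x)%:E + carleson_operator Rt alpha2 f2 y)%E.
  move=> Ry; rewrite opE; last by rewrite IE; right.
  rewrite (op0 a) // ?add0e; last by move=> Ly; rewrite -[False]/(set0 y) -LR0.
  congr (_ + _)%E; apply: eq_carleson_operator => // J RJ z /set_mem Jz.
  by apply: fR; apply/mem_set; apply: dyadic_sub mb RJ z Jz.
have sup : superlevel I alpha f (lam + t * x) =
    superlevel L alpha1 f1 lam `|` superlevel Rt alpha2 f2 lam.
  have thr u : ((lam + t * x)%:E < (t * x)%:E + u)%E = (lam%:E < u)%E.
    by rewrite EFinD addeC lteD2lE.
  apply/seteqP; split=> y /=.
    move=> [Iy]; have := Iy; rewrite {1}IE => -[Ly|Ry].
      by rewrite opL // thr; left.
    by rewrite opR // thr; right.
  move=> [[Ly h]|[Ry h]]; split.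
  - by rewrite IE; left.
  - by rewrite opL // thr.
  - by rewrite IE; right.
  - by rewrite opR // thr.
split => //.
- move=> J; rewrite (dyadicE ab) => -[->|[LJ|RJ]].
  + rewrite massI leb_itv // lee_fin ler_piMl // subr_ge0 ltW //.
  + rewrite (@eq_carleson_mass _ _ alpha1) ?(mass_carleson r1) // => K JK.
    by apply: alphaL; apply: dyadic_trans JK.
  + rewrite (@eq_carleson_mass _ _ alpha2) ?(mass_carleson r2) // => K JK.
    by apply: alphaR; apply: dyadic_trans JK.
- rewrite sup; apply: measurableU.
    exact: superlevel_measurable r1. exact: superlevel_measurable r2.
- transitivity (leb (superlevel L alpha1 f1 lam) +
                leb (superlevel Rt alpha2 f2 lam))%E; last first.
    rewrite (superlevel_leb r1) (superlevel_leb r2) -EFinD /c; congr EFin; lra.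
  rewrite sup; apply: measureU.
  + exact: superlevel_measurable r1.
  + exact: superlevel_measurable r2.
  + by apply/seteqP; split=> // y [[Ly _] [Ry _]]; rewrite -LR0.
Qed.

Lemma attains_glue (R : realType) (x1 A1 m1 x2 A2 m2 lam t : R) :
  0 <= t -> (A1 + A2) / 2 + t <= 1 ->
  attains x1 A1 lam m1 -> attains x2 A2 lam m2 ->
  attains ((x1 + x2) / 2) ((A1 + A2) / 2 + t) (lam + t * ((x1 + x2) / 2))
    ((m1 + m2) / 2).
Proof.
move=> t0 At1 h1 h2 a b ab; have /andP[am mb] := midpoint_lt ab.
have [f1 [alpha1 r1]] := h1 _ _ am; have [f2 [alpha2 r2]] := h2 _ _ mb.
by do 2!eexists; apply: realizes_glue r1 r2.
Qed.

(** * The extremal trajectory *)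

Lemma pow2V_gt0 (R : realType) (n : nat) : 0 < 2^-n :> R.
Proof. by rewrite invr_gt0 exprn_gt0. Qed.

Lemma pow2VS (R : realType) (n : nat) : 2^-n.+1 = 2^-n / 2 :> R.
Proof. by rewrite exprSr invfM. Qed.

Lemma pow2V_le_half (R : realType) (n : nat) : (0 < n)%N -> 2^-n <= 2^-1 :> R.
Proof.
by move=> n0; rewrite lef_pV2 ?posrE ?exprn_gt0 // -[leLHS]expr1 ler_eXn2l // ltr1n.
Qed.

(** A proportion 2^-n is removed by n halvings: each time one half carries the
given configuration in full and the process goes on in the other half, whose
last remnant is empty of density and weights. *)
Lemma attains_spread (R : realType) (x lam m : R) (n : nat) :
  0 <= lam -> attains x 1 lam m ->
  attains ((1 - 2^-n) * x) (1 - 2^-n) lam ((1 - 2^-n) * m).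
Proof.
move=> lam0 hx; elim: n => [|n IH].
  have := @attains_const R 0 0 lam (lexx _) _; rewrite mulr0 ltNge lam0 /=.
  by rewrite expr0 invr1 subrr !mul0r; apply; rewrite lexx ler01.
have e := pow2VS R n.
have d0 := pow2V_gt0 R n.
have := @attains_glue R x 1 m _ _ _ lam 0 (lexx _) _ hx IH.
rewrite mul0r !addr0 e.
have -> : (1 + (1 - 2^-n)) / 2 = 1 - 2^-n / 2 :> R by lra.
have -> : (x + (1 - 2^-n) * x) / 2 = (1 - 2^-n / 2) * x by lra.
have -> : (m + (1 - 2^-n) * m) / 2 = (1 - 2^-n / 2) * m by lra.
by apply; lra.
Qed.

(** The weight 2^-n is added in the topmost gluing of the spreading, so that
Carleson average 1 is reached again on the whole interval. *)
Lemma attains_step (R : realType) (x lam m : R) (n : nat) : (0 < n)%N ->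
  0 <= lam -> attains (x / (1 - 2^-n)) 1 lam m ->
  attains x 1 (lam + 2^-n * x) ((1 - 2^-n) * m).
Proof.
case: n => // n _ lam0 hx.
have e := pow2VS R n.
have d0 := pow2V_gt0 R n.
have d1 : 2^-n <= 1 :> R by rewrite invf_le1 ?exprn_gt0 // exprn_ege1 // ler1n.
have := @attains_glue R _ 1 m _ _ _ lam (2^-n.+1) _ _ hx
  (attains_spread n lam0 hx).
set y := x / _; have yx : x = (1 - 2^-n / 2) * y.
  by rewrite /y e mulrC divfK //; lra.
rewrite yx e.
have -> : (1 + (1 - 2^-n)) / 2 + 2^-n / 2 = 1 :> R by lra.
have -> : (y + (1 - 2^-n) * y) / 2 = (1 - 2^-n / 2) * y by lra.
have -> : (m + (1 - 2^-n) * m) / 2 = (1 - 2^-n / 2) * m by lra.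
by apply; lra.
Qed.

(** After k steps the density is x p^-k and the weights have contributed
(1 - p) x (1 + p^-1 + ... + p^-(k-1)) = x p (p^-k - 1).  The two bounds on lam
say that the weights of all N steps together do not pass the threshold, but that
a final weight 1, which contributes x p^-N, does. *)
Lemma attains_iter (R : realType) (n N : nat) (p x lam : R) : (0 < n)%N ->
  p = 1 - 2^-n ->
  0 < x -> x * p * (p^-N - 1) <= lam -> lam < x * p^-N + x * p * (p^-N - 1) ->
  attains x 1 lam (p ^+ N).
Proof.
move=> n0 pE.
have dn := pow2V_le_half R n0.
have d0 := pow2V_gt0 R n.
have p0 : 0 < p by lra.
have p1 : p <= 1 by lra.
elim: N x lam => [|N IH] x lam x0.
  rewrite !expr0 invr1 subrr mulr0 mulr1 addr0 => _ h.
  have := @attains_const R x 1 lam (ltW x0) _; rewrite mul1r h; apply.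
  by rewrite ler01 lexx.
(* as Q >= 1, lo gives lam >= x Q - x p >= (1 - p) x, so that the threshold is
   still nonnegative after one step *)
set Q := p^-N => lo hi.
have QS : p^-N.+1 = p^-1 * Q by rewrite exprS invfM.
have Q1 : 1 <= Q by rewrite invf_ge1 ?exprn_gt0 // exprn_ile1 // ltW.
have pV : p * p^-1 = 1 by rewrite divff // gt_eqF.
have dE : 2^-n = 1 - p by lra.
have -> : lam = (lam - 2^-n * x) + 2^-n * x by rewrite subrK.
have xpQ : x * p * (p^-N.+1 - 1) = x * Q - x * p.
  by rewrite QS mulrBr mulr1 mulrA -[x * p * _]mulrA pV mulr1.
rewrite xpQ QS in lo hi.
have xQ : x <= x * Q by rewrite ler_peMr // ltW.
have xp1 : x / p * p = x by rewrite divfK // gt_eqF.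
have xpQ1 : x / p * Q = x * (p^-1 * Q) by rewrite mulrA.
have -> : p ^+ N.+1 = (1 - 2^-n) * p ^+ N by rewrite exprS -pE.
apply: attains_step => //; rewrite -?pE.
  by rewrite dE; lra.
apply: IH; rewrite -/Q ?divr_gt0 ?xp1 ?xpQ1 ?dE //; lra.
Qed.

Lemma exists_expr_lt (R : realType) (p e : R) : 0 <= p < 1 -> 0 < e ->
  exists N : nat, p ^+ N < e.
Proof.
move=> /andP[p0 p1] e0.
have : p ^+ n @[n --> \oo] --> 0 by apply: cvg_expr; rewrite ger0_norm.
move=> /cvgr0_norm_lt /(_ _ e0)[N _ /(_ N (leqnn N)) /=].
by rewrite ger0_norm ?exprn_ge0 // => ?; exists N.
Qed.

Theorem theorem4p4 (R : realType) (x : R) (x_gt0 : 0 < x) (x_lt1 : x < 1) :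
  exists C : R, forall (eps : R), 0 < eps -> forall (a b : R), a < b ->
    let I : set R := `[a, b[%classic in
    exists (f : R -> R) (alpha : set R -> R),
      (forall y, I y -> 0 <= f y) /\
      (@lebesgue_measure R).-integrable I (EFin \o f) /\
      average f I = x /\
      carleson_sequence I alpha /\
      (carleson_constant I alpha <= 1)%E /\
      carleson_average alpha I = 1%E /\
      (`| ((fine (leb I))^-1)%:E *
          leb [set y | I y /\ (1 < carleson_operator I alpha f y)%E]
          - (2 * x / (x + 1))%:E | <= (C * eps)%:E)%E.
Proof.
exists 2 => eps eps0 a b ab I.
have [n n0 deps] : exists2 n, (0 < n)%N & (2^-n : R) < eps.
  have [k hk] := @exists_expr_lt R 2^-1 eps ltac:(lra) eps0.
  exists k.+1 => //; apply: le_lt_trans hk.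
  by rewrite exprVn lef_pV2 ?posrE ?exprn_gt0 // ler_eXn2l // ltr1n.
have [p pE] : exists p : R, p = 1 - 2^-n by exists (1 - 2^-n).
have d0 := pow2V_gt0 R n.
have dn := pow2V_le_half R n0.
have p0 : 0 < p by lra.
have p1 : p < 1 by lra.
pose T := x * (1 + p) / (1 + x * p).
have xp0 : 0 < x * p by rewrite mulr_gt0.
have D0 : 0 < 1 + x * p by lra.
have T0 : 0 < T by rewrite /T divr_gt0 // mulr_gt0 //; lra.
have exN : exists N, p ^+ N < T by apply: exists_expr_lt; rewrite // (ltW p0).
case: (ex_minnP exN) => N NT Nmin.
have T1 : T < 1 by rewrite /T ltr_pdivrMr // mul1r; lra.
(* N is positive, and its predecessor violates the strict bound T *)
have TN : p * T <= p ^+ N.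
  case: N NT Nmin => [|N] NT Nmin; first by move: NT; rewrite expr0 ltNge ltW.
  rewrite exprS ler_pM2l // leNgt; apply/negP => /Nmin.
  by rewrite ltnn.
set m := p ^+ N in NT TN.
have m0 : 0 < m by rewrite exprn_gt0.
have mhi : m * (1 + x * p) < x * (1 + p) by rewrite -ltr_pdivlMr.
have mlo : p * (x * (1 + p)) <= m * (1 + x * p) by rewrite -ler_pdivrMr // -mulrA.
have hx : attains x 1 1 m.
  apply: (@attains_iter R n N p x 1 n0 pE x_gt0).
    rewrite -/m -(ler_pM2r m0) mul1r.
    have -> : x * p * (m^-1 - 1) * m = x * p * (1 - m).
      by rewrite -mulrA mulrBl mulVf ?gt_eqF // mul1r.
    have : 0 <= x * p * p by rewrite !mulr_ge0 // ltW.
    lra.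
  rewrite -/m -(ltr_pM2r m0) mul1r.
  have -> : (x * m^-1 + x * p * (m^-1 - 1)) * m = x * (1 + p) - m * (x * p).
    by rewrite mulrDl -!mulrA mulrBl mulVf ?gt_eqF //; ring.
  lra.
have [f [alpha r]] := hx a b ab.
have ba0 : b - a != 0 by rewrite subr_eq0 gt_eqF.
have carl : (carleson_constant I alpha <= 1)%E.
  apply: ge_ereal_sup => _ [J IJ <-].
  have [c [d [_ cd _ EJ]]] := dyadic_itv ab IJ.
  have := mass_carleson r IJ; rewrite /carleson_average -/(carleson_mass alpha J).
  rewrite EJ leb_itv //= => h.
  have dc0 : 0 < d - c by rewrite subr_gt0.
  have -> : 1%E = ((d - c)^-1%:E * (d - c)%:E)%E.
    by rewrite -EFinM mulVf // gt_eqF.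
  by rewrite lee_wpmul2l // lee_fin invr_ge0 ltW.
exists f, alpha; split; [|split; [|split; [|split; [|split; [|split]]]]] => //.
- by move=> y _; apply: density_ge0 r y.
- exact: density_integrable r.
- exact: average_itv ab (density_integral r).
- split; first by move=> J _; apply: weight_ge0 r J.
  by apply: le_lt_trans carl _; rewrite ltry.
- rewrite /carleson_average -/(carleson_mass alpha I) (mass_total r) leb_itv //=.
  by rewrite -EFinM mul1r mulVf.
- rewrite -/(superlevel I alpha f 1) (superlevel_leb r) leb_itv // [fine _]/=.
  rewrite -EFinM mulrCA mulVf // mulr1 -EFinB abse_EFin lee_fin.
  set s := 2 * x / (x + 1).
  move: (2^-n) pE d0 dn deps => d pE d0 dn deps.
  have x1 : 0 < x + 1 by lra.
  (* clearing denominators, the slack is d x (1 - x) *)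
  have hi : m <= s.
    rewrite /s ler_pdivlMr // -(ler_pM2r D0) mulrAC.
    apply: le_trans (_ : x * (1 + p) * (x + 1) <= _).
      by rewrite ler_pM2r // ltW.
    have : 0 <= d * x * (1 - x) by rewrite !mulr_ge0 // ?subr_ge0 ltW.
    by rewrite pE; lra.
  (* the lower bound p T of m leaves the slack d ((x^2 + x) (1 - d) + 2) *)
  have lo : s <= m + 2 * d.
    rewrite /s ler_pdivrMr // -(ler_pM2r D0) [leRHS]mulrAC [(m + _) * _]mulrDl.
    apply: le_trans (_ : (p * (x * (1 + p)) + 2 * d * (1 + x * p)) * (x + 1) <= _).
      have : 0 <= d * (x * x + x) * (1 - d).
        have xx : 0 <= x * x by rewrite mulr_ge0 // ltW.
        by apply: mulr_ge0; [apply: mulr_ge0|]; lra.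
      by rewrite pE; lra.
    by rewrite ler_pM2r // lerD2r.
  by rewrite ler_norml; apply/andP; split; lra.
Qed.
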